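(* Let $A_1,\ldots,A_m$ be real $n\times n$ matrices. Suppose $V:\mathbb{R}^n\to\mathbb{R}$ is a homogeneous and continuous function satisfying $V(x)>0$ for all $x\neq 0$ and $V(x)-V(A_ix)>0$ for all $x\neq 0$ and all $i=1,\ldots,m$ (i.e., $V$ is a common homogeneous and continuous Lyapunov function for the switched linear system $x_{k+1}\in \mathrm{conv}\{A_1x_k,\ldots,A_mx_k\}$). Let $\mathcal{S}:=\{x\in\mathbb{R}^n \mid V(x)\leq 1\}$. Then the Minkowski (gauge) norm $$W(x):=\inf\{t>0 \mid \tfrac{x}{t}\in \mathrm{conv}(\mathcal{S})\}$$ is a convex common Lyapunov function for the switched linear system; that is, $W$ is convex, $W(x)>0$ for all $x\neq 0$, and $W(A_ix)<W(x)$ for all $x\neq 0$ and all $i=1,\ldots,m$.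
   Context: $\mathrm{conv}$ denotes the convex hull. A function $V:\mathbb{R}^n\to\mathbb{R}$ is called homogeneous if there is $d>0$ such that $V(\lambda x)=|\lambda|^dV(x)$ for all $\lambda\in\mathbb{R}$ and $x\in\mathbb{R}^n$ (for example, a homogeneous polynomial of positive even degree). *)

(* Defs.v *)
From mathcomp Require Import all_boot all_order all_algebra.
From mathcomp Require Import all_classical all_reals all_analysis.

Set Implicit Arguments.
Unset Strict Implicit.
Unset Printing Implicit Defensive.

Import Order.TTheory GRing.Theory Num.Theory.
Import numFieldNormedType.Exports.

Local Open Scope classical_set_scope.
Local Open Scope ring_scope.

Definition convex_hull (R : realType) (E : lmodType R) (S : set E) : set E :=
  smallest (@convex_set R E) S.

(* The degree d is a positive real, not necessarily an integer; since d != 0,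
   powR gives 0 `^ d = 0. *)
Definition homogeneous_function (R : realType) (E : lmodType R) (V : E -> R) :
    Prop :=
  exists d : R, 0 < d /\
    forall (lambda : R) (x : E), V (lambda *: x) = `|lambda| `^ d * V x.

(* The infimum is the real-valued one, for which inf set0 = 0 by convention; a
   positive value at x thus entails that the defining set is nonempty. *)
Definition gauge_norm (R : realType) (E : lmodType R) (K : set E) (x : E) : R :=
  inf [set t : R | 0 < t /\ K (t^-1 *: x)].

(* Main.v *)
(* The ratio V (A_i x) / V x is constant along rays, so by compactness of the
   unit sphere it is bounded by some c < 1. With r = c^(1/d), homogeneity turns
   this into A_i S <= r S, an inclusion which passes to the convex hull of S and
   gives W (A_i x) <= r W x. As V is bounded below on the sphere, S and its
   convex hull are bounded, whence W x > 0 for x <> 0. Convexity of W only needs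
   the hull to be convex and absorbing. *)

Require Import Defs.
From mathcomp Require Import all_boot all_order all_algebra.
From mathcomp Require Import all_classical all_reals all_analysis.

Set Implicit Arguments.
Unset Strict Implicit.
Unset Printing Implicit Defensive.

Import Order.TTheory GRing.Theory Num.Theory.
Import numFieldNormedType.Exports.

Local Open Scope classical_set_scope.
Local Open Scope ring_scope.

(** * Convex sets and convex hulls *)

(** Trades the interval-typed weight of [convex_set] for two real weights, which suit the field
    computations below. *)
Lemma convex_setP (R : realType) (E : lmodType R) (K : set E) :
  convex_set K <->
  forall (x y : E) (a b : R), 0 <= a -> 0 <= b -> a + b = 1 ->
    K x -> K y -> K (a *: x + b *: y).
Proof.
split=> [Kconv x y a b a0 b0 ab1 Kx Ky|Kconv x y t].
- have a1 : a <= 1 by rewrite -ab1 lerDl.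
  have -> : b = 1 - a by rewrite -ab1 addrAC subrr add0r.
  have := Kconv x y (Itv01 a0 a1); rewrite !in_setE; exact.
- rewrite !in_setE => Kx Ky; apply: Kconv => //; last exact: unstable.add_onemK.
  by rewrite subr_ge0.
Qed.

Lemma convex_set_convex_hull (R : realType) (E : lmodType R) (S : set E) :
  convex_set (convex_hull S).
Proof.
apply/convex_setP => x y a b a0 b0 ab1 Sx Sy K [Kconv SK].
by have /convex_setP := Kconv; apply=> //; [apply: Sx|apply: Sy].
Qed.

Lemma sub_convex_hull (R : realType) (E : lmodType R) (S : set E) :
  S `<=` convex_hull S.
Proof. exact: sub_gen_smallest. Qed.

Lemma convex_hull_sub (R : realType) (E : lmodType R) (S K : set E) :
  convex_set K -> S `<=` K -> convex_hull S `<=` K.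
Proof. exact: smallest_sub. Qed.

(** * Gauges: convexity, behaviour under linear maps, positivity *)

Section gauge.
Context {R : realType} {E : lmodType R}.
Implicit Types (K : set E) (x y : E).

Lemma gauge_le K x (t : R) : 0 < t -> K (t^-1 *: x) -> gauge_norm K x <= t.
Proof.
by move=> t0 Kx; apply: ge_inf => //; exists 0 => u [/ltW].
Qed.

(** The existence hypothesis excludes the empty set, whose [inf] is 0 by convention and may lie
    below [c]. *)
Lemma le_gauge K x (c : R) :
    (exists2 t : R, 0 < t & K (t^-1 *: x)) ->
    (forall t : R, 0 < t -> K (t^-1 *: x) -> c <= t) ->
  c <= gauge_norm K x.
Proof.
by move=> [t t0 Kt] cle; apply: lb_le_inf; [exists t|
  move=> u [u0 Ku]; exact: cle].
Qed.

Lemma gauge_adherent K x (e : R) :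
    0 < e -> (exists2 t : R, 0 < t & K (t^-1 *: x)) ->
  exists t, [/\ 0 < t, K (t^-1 *: x) & t < gauge_norm K x + e].
Proof.
move=> e0 [t t0 Kt].
have [|u [u0 Ku] ult] :=
    @inf_adherent R [set t : R | 0 < t /\ K (t^-1 *: x)] e e0.
  by split; [exists t|exists 0 => u [/ltW]].
by exists u.
Qed.

(** Take [s] and [u] admissible for [x] and [y], within [e] of the infima. Then
    [w = a * s + (1 - a) * u] is admissible for the combination, since dividing it by [w] gives the
    convex combination of [x / s] and [y / u] with weights [a * s / w] and [(1 - a) * u / w]. *)
Lemma gauge_convex K :
    convex_set K ->
    (forall x, exists2 t : R, 0 < t & K (t^-1 *: x)) ->
  convex_function [set: E] (gauge_norm K).
Proof.
move=> /convex_setP Kconv Kabs t x y _ _.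
change (gauge_norm K (t%:num *: (x : E) + (1 - t%:num) *: (y : E)) <=
  t%:num * gauge_norm K x + (1 - t%:num) * gauge_norm K y).
have : 0 <= t%:num by [].
have : t%:num <= 1 by [].
move: t%:num => a a1 a0.
apply/ler_addgt0Pr => e e0.
have [s [s0 Ks slt]] := gauge_adherent e0 (Kabs x).
have [u [u0 Ku ult]] := gauge_adherent e0 (Kabs y).
have b0 : 0 <= 1 - a by rewrite subr_ge0.
set w := a * s + (1 - a) * u.
have w0 : 0 < w.
  have [a_eq0|an0] := eqVneq a 0.
    by rewrite /w a_eq0 mul0r add0r subr0 mul1r.
  apply: ltr_pwDl; last exact: mulr_ge0 b0 (ltW u0).
  by rewrite mulr_gt0// lt0r an0.
apply: (@le_trans _ _ w).
- apply: gauge_le => //.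
  rewrite (_ : _ *: _ = (a * s / w) *: (s^-1 *: x) +
                          ((1 - a) * u / w) *: (u^-1 *: y)).
    apply: Kconv => //.
    + by rewrite divr_ge0 ?mulr_ge0// ltW.
    + by rewrite divr_ge0 ?mulr_ge0// ltW.
    + by rewrite -mulrDl divff// gt_eqF.
  rewrite scalerDr !scalerA; congr (_ *: _ + _ *: _).
  + by rewrite mulrAC mulfK ?gt_eqF// mulrC.
  + by rewrite mulrAC mulfK ?gt_eqF// mulrC.
- rewrite (_ : _ + e = a * (gauge_norm K x + e) +
                         (1 - a) * (gauge_norm K y + e)).
    by rewrite lerD// ler_wpM2l// ltW.
  by rewrite !mulrDr addrACA -mulrDl [a + _]addrC subrK mul1r.
Qed.

(** The preimage of the hull under [y |-> f y / r] is convex and contains [S], hence contains the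
    hull. So if [t] is admissible for [x], then [r * t] is admissible for [f x]. *)
Lemma gauge_hull_linear_le (S : set E) (f : {linear E -> E}) (r : R) x :
    0 < r ->
    (forall y, S y -> S (r^-1 *: f y)) ->
    (exists2 t : R, 0 < t & convex_hull S (t^-1 *: x)) ->
  gauge_norm (convex_hull S) (f x) <= r * gauge_norm (convex_hull S) x.
Proof.
move=> r0 Sf xabs; rewrite mulrC -ler_pdivrMr//.
apply: le_gauge => // t t0 St; rewrite ler_pdivrMr//.
apply: gauge_le; first exact: mulr_gt0.
have : convex_hull S `<=` [set y | convex_hull S (r^-1 *: f y)].
  apply: convex_hull_sub => [|y Sy] /=; last first.
    by apply: sub_convex_hull; exact: Sf.
  apply/convex_setP => y z a b a0 b0 ab1 /= Sy Sz.
  rewrite linearD !linearZ scalerDr !scalerA [r^-1 * a]mulrC [r^-1 * b]mulrC.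
  rewrite -!scalerA.
  by have /convex_setP := @convex_set_convex_hull R E S; apply.
by move=> /(_ _ St); rewrite /= linearZ scalerA invfM mulrC.
Qed.

End gauge.

(** The ball of radius [M] is convex, so it contains the hull, and every admissible [t] is at least
    [|x| / M]. *)
Lemma gauge_hull_gt0 (R : realType) (E : normedModType R) (S : set E) (x : E)
    (M : R) :
    (forall y, S y -> `|y| <= M) ->
    (exists2 t : R, 0 < t & convex_hull S (t^-1 *: x)) ->
  x != 0 -> 0 < gauge_norm (convex_hull S) x.
Proof.
move=> SM xabs x0.
have hullM : convex_hull S `<=` [set y | `|y| <= M].
  apply: convex_hull_sub => //.
  apply/convex_setP => y z a b a0 b0 ab1 /= yM zM.
  rewrite (le_trans (ler_normD _ _))// !normrZ !ger0_norm//.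
  by rewrite -[leRHS]mul1r -ab1 mulrDl lerD// ler_wpM2l.
have tM t : 0 < t -> convex_hull S (t^-1 *: x) -> `|x| <= M * t.
  move=> t0 /hullM /=; rewrite normrZ gtr0_norm ?invr_gt0//.
  by rewrite mulrC ler_pdivrMr.
have nx0 : 0 < `|x| by rewrite normr_gt0.
(* Any admissible [t] gives [0 < |x| <= M * t], which forces [M] to be positive. *)
have M0 : 0 < M.
  case: xabs => t t0 /(tM _ t0) xMt.
  by rewrite -(pmulr_lgt0 _ t0) (lt_le_trans nx0).
apply: (@lt_le_trans _ _ (`|x| / M)); first by rewrite divr_gt0.
by apply: le_gauge => // t t0 /(tM _ t0); rewrite ler_pdivrMr// mulrC.
Qed.

Lemma linear_lipschitz_continuous (R : realType) (E F : normedModType R)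
    (f : {linear E -> F}) (k : R) :
  (forall x, `|f x| <= k * `|x|) -> continuous f.
Proof.
move=> fk; apply/linear_bounded_continuous/linear_boundedP.
exists k; split=> [|r kr x]; first exact: num_real.
by rewrite (le_trans (fk x))// ler_wpM2r// ltW.
Qed.

(** * Matrix norms, continuity and compactness of the sphere *)

Section matrix_topology.
Context {R : realType}.

Lemma mx_entry_le_norm m n (M : 'M[R]_(m, n)) i j : `|M i j| <= `|M|.
Proof.
rewrite [leRHS]/Num.norm /= mx_normrE; apply/bigmax_geP; right.
by exists (i, j).
Qed.

Lemma mx_norm_le m n (M : 'M[R]_(m, n)) (c : R) :
  0 <= c -> (forall i j, `|M i j| <= c) -> `|M| <= c.
Proof.
move=> c0 Mc; rewrite [leLHS]/Num.norm /= mx_normrE; apply/bigmax_leP.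
by split=> // -[i j] _; exact: Mc.
Qed.

(** The norm is the largest absolute entry, and each entry of the product sums [n] terms: hence the
    factor [n]. *)
Lemma mx_norm_mulmx m n p (A : 'M[R]_(m, n)) (B : 'M[R]_(n, p)) :
  `|A *m B| <= `|A| *+ n * `|B|.
Proof.
apply: mx_norm_le => [|i j]; first by rewrite mulr_ge0// mulrn_wge0.
rewrite mxE (le_trans (ler_norm_sum _ _ _))//.
have -> : `|A| *+ n * `|B| = \sum_(k < n) `|A| * `|B|.
  by rewrite sumr_const card_ord mulrnAl.
apply: ler_sum => k _.
by rewrite normrM ler_pM// mx_entry_le_norm.
Qed.

Lemma mx_norm_tr m n (M : 'M[R]_(m, n)) : `|M^T| = `|M|.
Proof.
have le_tr p q (N : 'M[R]_(p, q)) : `|N^T| <= `|N|.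
  by apply: mx_norm_le => // i j; rewrite mxE mx_entry_le_norm.
by apply/eqP; rewrite eq_le le_tr -{1}[M]trmxK le_tr.
Qed.

Lemma continuous_trmx m n : continuous (@trmx R m n).
Proof.
apply: (@linear_lipschitz_continuous R 'M[R]_(m, n) 'M[R]_(n, m) trmx 1) => x.
by rewrite mul1r mx_norm_tr.
Qed.

Lemma continuous_mulmx m n p (A : 'M[R]_(m, n)) : continuous (@mulmx R m n p A).
Proof.
apply: (@linear_lipschitz_continuous R 'M[R]_(n, p) 'M[R]_(m, p) (mulmx A)).
move=> x; exact: mx_norm_mulmx.
Qed.

(** Heine-Borel is applied to row vectors; transposition, a continuous isometry, carries the result
    to columns. *)
Lemma compact_cV_sphere n : compact [set x : 'cV[R]_n | `|x| = 1].
Proof.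
have -> : [set x : 'cV[R]_n | `|x| = 1] =
    trmx @` [set x : 'rV[R]_n | `|x| = 1].
  apply/seteqP; split => [x /= x1|_ [x /= x1 <-]]; last first.
    by rewrite /= mx_norm_tr.
  by exists x^T; rewrite ?trmxK//= mx_norm_tr.
apply: continuous_compact.
  exact/continuous_subspaceT/continuous_trmx.
apply: bounded_closed_compact.
  by exists 1; split => // M M1 x /= ->; exact: ltW.
apply: (@preimage_closed _ _ (fun x : 'rV[R]_n => `|x|) [set 1]).
  by move=> x _; exact: norm_continuous.
exact: closed_eq.
Qed.

(** Continuity is asked only away from 0 because [f] will be a quotient with denominator [V]; [x]
    ensures that the sphere is nonempty. *)
Lemma sphere_EVT_max n (f : 'cV[R]_n -> R) (x : 'cV[R]_n) :
    x != 0 -> (forall y, y != 0 -> {for y, continuous f}) ->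
  exists2 y, y != 0 & forall z, `|z| = 1 -> f z <= f y.
Proof.
move=> x0 fcont.
have sphere_neq0 (y : 'cV[R]_n) : `|y| = 1 -> y != 0.
  by move=> y1; rewrite -normr_gt0 y1.
have [||y y1 fy] := @compact_EVT_max _ R f _ _ (@compact_cV_sphere n).
- exists (`|x|^-1 *: x) => /=.
  by rewrite normrZ normfV normr_id mulVf// normr_eq0.
- apply: continuous_in_subspaceT => y /set_mem /= /sphere_neq0; exact: fcont.
- exists y; first exact/sphere_neq0/set_mem.
  by move=> z z1; apply/fy/mem_set.
Qed.

End matrix_topology.

(** * Positive homogeneous functions and their unit sublevel set *)

Section homogeneous.
Context {R : realType} {n : nat} {V : 'cV[R]_n -> R} {d : R}.
Hypothesis d_gt0 : 0 < d.
Hypothesis V_homo : forall (l : R) x, V (l *: x) = `|l| `^ d * V x.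
Hypothesis V_cont : continuous V.
Hypothesis V_gt0 : forall x, x != 0 -> 0 < V x.

Lemma homogeneous0 : V 0 = 0.
Proof. by rewrite -(scale0r 0) V_homo normr0 powR0 ?mul0r// gt_eqF. Qed.

Lemma homogeneous_ge0 x : 0 <= V x.
Proof.
by have [->|/V_gt0/ltW//] := eqVneq x 0; rewrite homogeneous0.
Qed.

Lemma homogeneous_scaleV (l : R) x : 0 < l ->
  V ((l `^ d^-1)^-1 *: x) = l^-1 * V x.
Proof.
move=> l0; rewrite V_homo ger0_norm ?invr_ge0 ?powR_ge0//.
rewrite -powRN -powRrM mulNr mulVf ?gt_eqF// powR_inv1//; exact: ltW.
Qed.

Lemma sublevel_absorbing x : exists2 t : R, 0 < t & V (t^-1 *: x) <= 1.
Proof.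
have [->|x0] := eqVneq x 0.
  by exists 1; rewrite ?ltr01// scaler0 homogeneous0.
(* This factor brings [x] onto the level set where [V] equals 1. *)
exists (V x `^ d^-1); first exact/powR_gt0/V_gt0.
by rewrite homogeneous_scaleV ?V_gt0// mulVf// gt_eqF// V_gt0.
Qed.

Lemma homogeneous_normalize x : x != 0 ->
  `| `|x|^-1 *: x| = 1 /\ V x = `|x| `^ d * V (`|x|^-1 *: x).
Proof.
move=> x0; have nx : `|x| != 0 by rewrite normr_eq0.
split; first by rewrite normrZ normfV normr_id mulVf.
by have := V_homo `|x| (`|x|^-1 *: x); rewrite normr_id scalerA divff// scale1r.
Qed.

Lemma sublevel_bounded : exists M : R, forall x, V x <= 1 -> `|x| <= M.
Proof.
have [[x0 x0_neq0]|all0] := pselect (exists x : 'cV[R]_n, x != 0); last first.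
  exists 0 => x _; have [->|x0] := eqVneq x 0; first by rewrite normr0.
  by exfalso; apply: all0; exists x.
(* Maximising [1 / V] locates the minimum of [V] on the sphere; the bound on the sublevel set is the
   [d]-th root of that maximum. *)
have [|y y0 ymax] := @sphere_EVT_max R n (fun x => (V x)^-1) x0 x0_neq0.
  move=> z z0; apply: continuousV; last exact: V_cont.
  by rewrite gt_eqF// V_gt0.
exists ((V y)^-1 `^ d^-1) => x Vx1.
have [->|x_neq0] := eqVneq x 0; first by rewrite normr0 powR_ge0.
have [n1 Vx] := homogeneous_normalize x_neq0.
have u0 : 0 < V (`|x|^-1 *: x) by apply: V_gt0; rewrite -normr_gt0 n1.
have : `|x| `^ d <= (V y)^-1.
  by apply: le_trans (ymax _ n1); rewrite -[leRHS]mul1r ler_pdivlMr// -Vx.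
move=> /(ge0_ler_powR (r := d^-1)); rewrite -powRrM divff ?gt_eqF// powRr1//.
by apply; rewrite ?nnegrE ?powR_ge0 ?invr_ge0 ?homogeneous_ge0// ltW.
Qed.

Lemma uniform_decrease (A : 'M[R]_n) :
    (forall x, x != 0 -> V (A *m x) < V x) ->
  exists c : R, [/\ 0 < c, c < 1 & forall x, V (A *m x) <= c * V x].
Proof.
move=> Adecr.
have V0 x : x = 0 -> V (A *m x) = 0 by move=> ->; rewrite mulmx0 homogeneous0.
have [[x0 x0_neq0]|all0] := pselect (exists x : 'cV[R]_n, x != 0); last first.
  exists 2^-1; split; rewrite ?invr_gt0 ?invf_lt1 ?ltr1n// => x.
  have [x0|x0] := eqVneq x 0; first by rewrite V0// mulr_ge0// homogeneous_ge0.
  by exfalso; apply: all0; exists x.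
have [|y y0 ymax] := @sphere_EVT_max R n (fun x => V (A *m x) / V x) x0 x0_neq0.
  move=> z z0; apply: continuousM.
    by apply: continuous_comp; [exact: continuous_mulmx|exact: V_cont].
  by apply: continuousV; [rewrite gt_eqF// V_gt0|exact: V_cont].
set q := V (A *m y) / V y in ymax.
have q0 : 0 <= q by rewrite divr_ge0// homogeneous_ge0.
have q1 : q < 1 by rewrite ltr_pdivrMr ?V_gt0// mul1r Adecr.
have [qc c1] := midf_lt q1.
(* The maximal ratio [q] may be 0, for instance when [A = 0]; the midpoint of [q] and 1 is positive
   and still below 1. *)
exists ((q + 1) / 2); split => // [|x]; first exact: le_lt_trans qc.
have [x_eq0|x_neq0] := eqVneq x 0.
  by rewrite V0// mulr_ge0// ?homogeneous_ge0// (le_trans q0)// ltW.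
have [n1 Vx] := homogeneous_normalize x_neq0.
have u0 : 0 < V (`|x|^-1 *: x) by apply: V_gt0; rewrite -normr_gt0 n1.
have -> : V (A *m x) = `|x| `^ d * V (A *m (`|x|^-1 *: x)).
  have := V_homo `|x| (A *m (`|x|^-1 *: x)).
  by rewrite normr_id scalemxAr scalerA divff ?scale1r// normr_eq0.
rewrite Vx mulrCA ler_wpM2l ?powR_ge0// -ler_pdivrMr//.
by rewrite (le_trans (ymax _ n1))// ltW.
Qed.

End homogeneous.

Theorem proposition3p1 (R : realType) (n m : nat) (A : 'I_m -> 'M[R]_n)
    (V : 'cV[R]_n -> R)
    (V_homogeneous : homogeneous_function V)
    (V_continuous : continuous V)
    (V_pos : forall x : 'cV[R]_n, x != 0 -> 0 < V x)
    (V_decr : forall (i : 'I_m) (x : 'cV[R]_n),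
      x != 0 -> 0 < V x - V (A i *m x)) :
  let S := [set x : 'cV[R]_n | V x <= 1] in
  let W := gauge_norm (convex_hull S) in
  [/\ convex_function [set: 'cV[R]_n] W,
      forall x : 'cV[R]_n, x != 0 -> 0 < W x
    & forall (i : 'I_m) (x : 'cV[R]_n), x != 0 -> W (A i *m x) < W x].
Proof.
move=> S W; have [d [d0 Vhomo]] := V_homogeneous.
have Sabs x : exists2 t : R, 0 < t & convex_hull S (t^-1 *: x).
  have [t t0 St] := sublevel_absorbing d0 Vhomo V_pos x.
  by exists t => //; exact: sub_convex_hull.
have Wpos x : x != 0 -> 0 < W x.
  have [M SM] := sublevel_bounded d0 Vhomo V_continuous V_pos.
  by move=> x0; apply: (gauge_hull_gt0 SM).
split => // [|i x x0].
  by apply: gauge_convex => //; exact: convex_set_convex_hull.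
have Adecr y : y != 0 -> V (A i *m y) < V y.
  by move=> /(V_decr i); rewrite subr_gt0.
have [c [c0 c1 Vc]] := uniform_decrease d0 Vhomo V_continuous V_pos Adecr.
have r0 : 0 < c `^ d^-1 by exact: powR_gt0.
have r1 : c `^ d^-1 < 1.
  have <- : 1 `^ d^-1 = 1 by rewrite powR1.
  by rewrite gt0_ltr_powR ?invr_gt0// nnegrE ltW.
apply: (@le_lt_trans _ _ (c `^ d^-1 * W x)).
  apply: (@gauge_hull_linear_le _ _ S (mulmx (A i))) => // y Sy.
  (* Scaling by [c^(-1/d)] divides [V] by [c], so the claim becomes [V (A i *m y) <= c], which
     follows from [V (A i *m y) <= c * V y] and [V y <= 1]. *)
  rewrite /S /= homogeneous_scaleV// mulrC ler_pdivrMr// mul1r.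
  by rewrite (le_trans (Vc y))// ler_piMr// ltW.
by rewrite gtr_pMl// Wpos.
Qed.
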